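(* With data, cone $K$ and constants $m_i$, $M_i$, $c_{\gamma_i}$ as in the context, let $f_i:[0,+\infty)\times\mathbb R\to[0,+\infty)$ for $i=1,2$, and assume that there exist $A_1,A_2,\lambda_1,\lambda_2>0$ such that for one index $i\in\{1,2\}$ one has - $H_i[u_1,u_2]\le A_i\|u_i\|$ for all $(u_1,u_2)\in K$, - $f_i(z_1,z_2)\le\lambda_im_i|z_i|$ for all $(z_1,z_2)\in[0,+\infty)\times\mathbb R$, - $\|\gamma_i\|A_i+\lambda_i<1$, and for the other index $j\in\{1,2\}$, $j\neq i$, one has - $H_j[u_1,u_2]\ge A_j\|u_j\|$ for all $(u_1,u_2)\in K$, - $f_j(z_1,z_2)\ge\lambda_jM_jz_j$ for all $(z_1,z_2)\in[0,+\infty)\times\mathbb R$, - $c_{\gamma_j}\|\gamma_j\|A_j+\lambda_j>1$. Then the system $$u(t)=\gamma_1(t)H_1[u,v]+\int_0^1k_1(t,s)g_1(s)f_1(u(s),v(s))\,ds,\qquad v(t)=\gamma_2(t)H_2[u,v]+\int_0^1k_2(t,s)g_2(s)f_2(u(s),v(s))\,ds,\qquad t\in[0,1],$$ has no nontrivial solution in $K$, i.e. no solution $(u,v)\in K$ with $\|(u,v)\|>0$.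
   Context: **Data.** Let $n\ge 3$, $R_1>0$, $R_\eta,R_\xi\in(R_1,+\infty)$, $\beta_1,\delta_1\in\mathbb R$. For $t\in(0,1]$ put $r(t)=R_1t^{\frac1{2-n}}$ and $\phi(t)=r(t)\frac{R_1}{(n-2)^2}t^{\frac{2n-3}{2-n}}$. Let $\eta,\xi\in(0,1)$ be such that $r(\eta)=R_\eta$, $r(\xi)=R_\xi$, and put $\beta_2=(2-n)\delta_1\frac{\xi}{R_\xi}$. Assume $1\le\beta_1<\frac1\eta$ and $0\le\beta_2<1-\xi$. For $i=1,2$: $f_i$ is continuous; $h_i:[R_1,+\infty)\to[0,+\infty)$ is continuous and, for some $\mu_i>0$, $h_i(\rho)\le\rho^{-(n+\mu_i)}$ for all sufficiently large $\rho$; $g_i(t)=\phi(t)h_i(r(t))$. **Kernels.** $$k_1(t,s)=\frac{t(1-s)}{1-\beta_1\eta}-\begin{cases}\frac{\beta_1t(\eta-s)}{1-\beta_1\eta},&s\le\eta\\0,&s>\eta\end{cases}-\begin{cases}t-s,&s\le t\\0,&s>t\end{cases}$$ $$k_2(t,s)=\frac{t(1-s)}{1-\beta_2}-\begin{cases}\frac{\beta_2t}{1-\beta_2},&s\le\xi\\0,&s>\xi\end{cases}-\begin{cases}t-s,&s\le t\\0,&s>t\end{cases}$$ $$\gamma_1(t)=1+\frac{(\beta_1-1)t}{1-\beta_1\eta},\quad \gamma_2(t)=1-\frac t{1-\beta_2},\quad \Phi_1(s)=\frac{\beta_1s(1-s)}{1-\beta_1\eta},\quad \Phi_2(s)=\max\{1,\beta_2/\xi\}\frac{s(1-s)}{1-\beta_2}.$$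 **Constants.** Fix intervals $[a_1,b_1]\subset(0,1]$, $[a_2,b_2]\subset(0,1-\beta_2)$ and assume $\int_{a_i}^{b_i}\Phi_i(s)g_i(s)\,ds>0$ for $i=1,2$. Put $$c_{k_1}=\min\{a_1\eta,4a_1(1-\beta_1\eta)\eta,\eta(1-\beta_1\eta)\},\quad c_{k_2}=\frac{\min\{4a_2(1-\beta_2-\xi),\,1-b_2-\beta_2\}}{\max\{1,\beta_2/\xi\}},$$ $$c_{\gamma_1}=\frac{\beta_1-1}{\beta_1(1-\eta)}a_1+\frac{1-\beta_1\eta}{\beta_1(1-\eta)},\qquad c_{\gamma_2}=\begin{cases}\frac{1-\beta_2}{\beta_2}-\frac{b_2}{\beta_2},&\beta_2\ge1/2\\1-\frac{b_2}{1-\beta_2},&\beta_2\le1/2\end{cases}$$ and $c_i=\min\{c_{k_i},c_{\gamma_i}\}$. Put $$\frac1{m_i}=\sup_{t\in[0,1]}\int_0^1|k_i(t,s)|g_i(s)\,ds,\qquad \frac1{M_i}=\inf_{t\in[a_i,b_i]}\int_{a_i}^{b_i}k_i(t,s)g_i(s)\,ds.$$ **Cone.** $\|w\|=\max_{[0,1]}|w|$ on $C[0,1]$, $\|(u,v)\|=\max\{\|u\|,\|v\|\}$, and $K_1=\{w\in C[0,1]:w\ge0,\ \min_{[a_1,b_1]}w\ge c_1\|w\|\}$, $K_2=\{w\in C[0,1]:\min_{[a_2,b_2]}w\ge c_2\|w\|\}$, $K=K_1\times K_2$. For $i=1,2$, $H_i:K\to[0,\infty)$ is a compact functional (continuous,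 mapping bounded sets to relatively compact sets). *)

(* Defs.v *)
From HB Require Import structures.
From mathcomp Require Import all_boot all_order all_algebra.
From mathcomp Require Import all_classical all_reals all_analysis.

Set Implicit Arguments.
Unset Strict Implicit.
Unset Printing Implicit Defensive.

Import Order.TTheory GRing.Theory Num.Theory.
Import numFieldNormedType.Exports.

Local Open Scope classical_set_scope.
Local Open Scope ring_scope.

Definition radius_of (R : realType) (n : nat) (R1 t : R) : R :=
  R1 * t `^ (1 / (2 - n%:R)).

Definition phi (R : realType) (n : nat) (R1 t : R) : R :=
  radius_of n R1 t * (R1 / (n%:R - 2) ^+ 2 * t `^ ((2 * n%:R - 3) / (2 - n%:R))).

(* The weight is only meaningful on ]0, 1]; it may be unbounded near 0, so the
   integrals against it below are Lebesgue integrals. *)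
Definition weight (R : realType) (n : nat) (R1 : R) (h : R -> R) (t : R) : R :=
  phi n R1 t * h (radius_of n R1 t).

Definition admissible (R : realType) (n : nat) (R1 : R) (h : R -> R) : Prop :=
  [/\ {within `[R1, +oo[, continuous h},
      forall rho, R1 <= rho -> 0 <= h rho
    & exists2 mu : R, 0 < mu &
        \forall rho \near +oo, h rho <= rho `^ (- (n%:R + mu))].

Definition k1 (R : realType) (beta1 eta t s : R) : R :=
  t * (1 - s) / (1 - beta1 * eta)
  - (if s <= eta then beta1 * t * (eta - s) / (1 - beta1 * eta) else 0)
  - (if s <= t then t - s else 0).

Definition k2 (R : realType) (beta2 xi t s : R) : R :=
  t * (1 - s) / (1 - beta2)
  - (if s <= xi then beta2 * t / (1 - beta2) else 0)
  - (if s <= t then t - s else 0).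

Definition gamma1 (R : realType) (beta1 eta t : R) : R :=
  1 + (beta1 - 1) * t / (1 - beta1 * eta).

Definition gamma2 (R : realType) (beta2 t : R) : R := 1 - t / (1 - beta2).

Definition Phi1 (R : realType) (beta1 eta s : R) : R :=
  beta1 * s * (1 - s) / (1 - beta1 * eta).

Definition Phi2 (R : realType) (beta2 xi s : R) : R :=
  Num.max 1 (beta2 / xi) * (s * (1 - s) / (1 - beta2)).

Definition ck1 (R : realType) (beta1 eta a1 : R) : R :=
  Num.min (Num.min (a1 * eta) (4 * a1 * (1 - beta1 * eta) * eta))
          (eta * (1 - beta1 * eta)).

Definition ck2 (R : realType) (beta2 xi a2 b2 : R) : R :=
  Num.min (4 * a2 * (1 - beta2 - xi)) (1 - b2 - beta2)
  / Num.max 1 (beta2 / xi).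

Definition cgamma1 (R : realType) (beta1 eta a1 : R) : R :=
  (beta1 - 1) / (beta1 * (1 - eta)) * a1
  + (1 - beta1 * eta) / (beta1 * (1 - eta)).

Definition cgamma2 (R : realType) (beta2 b2 : R) : R :=
  if 1 / 2 <= beta2 then (1 - beta2) / beta2 - b2 / beta2
  else 1 - b2 / (1 - beta2).

Definition m_const (R : realType) (k : R -> R -> R) (g : R -> R) : R :=
  (sup [set (\int[lebesgue_measure]_(s in `[0%R, 1%R]) (`|k t s| * g s))%R
       | t in `[0, 1]])^-1.

Definition M_const (R : realType) (k : R -> R -> R) (g : R -> R) (a b : R) : R :=
  (inf [set (\int[lebesgue_measure]_(s in `[a, b]) (k t s * g s))%R
       | t in `[a, b]])^-1.

(* Functions on R with the topology of uniform convergence on [0, 1]; C01 R is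
   the set of those that are continuous on [0, 1].  Values outside [0, 1] are
   irrelevant: a real-valued map that is continuous for this topology takes the
   same value at functions that agree on [0, 1]. *)
Definition fun01 (R : realType) : Type := {uniform` `[(0 : R), 1] -> R}.

Definition C01 (R : realType) : set (fun01 R) :=
  [set w | {within `[0, 1], continuous (w : R -> R)}].

(* For w continuous on [0, 1] (resp. [a, b]), this sup (resp. the inf below) is
   attained, i.e. it is a max (resp. a min). *)
Definition norm01 (R : realType) (w : R -> R) : R :=
  sup [set `|w t| | t in `[0, 1]].

Definition norm01_pair (R : realType) (p : fun01 R * fun01 R) : R :=
  Num.max (norm01 p.1) (norm01 p.2).

Definition min_on (R : realType) (a b : R) (w : R -> R) : R :=
  inf [set w t | t in `[a, b]].

Definition cone1 (R : realType) (a b c : R) : set (fun01 R) :=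
  [set w | [/\ C01 w, forall t, t \in `[0, 1] -> 0 <= w t
             & min_on a b w >= c * norm01 w]].

Definition cone2 (R : realType) (a b c : R) : set (fun01 R) :=
  [set w | C01 w /\ min_on a b w >= c * norm01 w].

Definition compact_functional (R : realType) (K : set (fun01 R * fun01 R))
    (H : fun01 R * fun01 R -> R) : Prop :=
  {within K, continuous H} /\
  forall B : set (fun01 R * fun01 R), B `<=` K ->
    (exists r : R, forall p, B p -> norm01_pair p <= r) ->
    precompact (H @` B).

Definition hammerstein (R : realType) (gamma : R -> R) (k : R -> R -> R)
    (g : R -> R) (f : R * R -> R) (H : fun01 R * fun01 R -> R)
    (p : fun01 R * fun01 R) (t : R) : R :=
  gamma t * H p
  + (\int[lebesgue_measure]_(s in `[0%R, 1%R])
       (k t s * g s * f (p.1 s, p.2 s)))%R.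

(* Main.v *)
Require Import Defs.
From HB Require Import structures.
From mathcomp Require Import all_boot all_order all_algebra.
From mathcomp Require Import all_classical all_reals all_analysis.
From mathcomp Require Import measurable_realfun ring lra.
Set Implicit Arguments.
Unset Strict Implicit.
Unset Printing Implicit Defensive.
Import Order.TTheory GRing.Theory Num.Theory.
Import numFieldNormedType.Exports.
Local Open Scope classical_set_scope.
Local Open Scope ring_scope.

(** The two equations are compared with the norm of their own component, one
    from above and one from below, and each comparison kills that component.

    Upper comparison.  Taking absolute values in
    [w t = gam t * H + \int k t s g s F s], with [H <= A |w|] and
    [F <= lambda m |w|], gives [|w| <= (|gam| A + lambda) |w|], because [1 / m]
    bounds every [\int |k t s| g s].  The factor is below 1, so [|w| = 0]
    ([norm01_le0_small]).

    Lower comparison.  Let [sigma] be the minimum of [w] over [[a, b]].  On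
    that interval the kernel is nonnegative, so the integral over [[0, 1]] can
    be cut down to [[a, b]], where [F >= lambda M sigma]; and
    [gam >= c_gam |gam|] there.  Hence
    [sigma >= c_gam |gam| A |w| + lambda sigma
           >= (c_gam |gam| A + lambda) sigma] with a factor above 1, so
    [sigma <= 0].  The cone inequality [c |w| <= sigma] with [c > 0] turns this
    into [|w| = 0] ([norm01_le0_large]).

    These arguments presuppose that the integrals behave.  The weight [g] may
    be unbounded at 0, but the decay of [h] at infinity makes it
    [O(t^(a - 1))] with [a > 0], hence integrable ([integrable_weight]).  Since
    [m] and [M] are inverses of a supremum and an infimum, and inversion sends
    0 to 0, the lower comparison really needs the infimum to be positive: this
    comes from a bound [k t s >= c Phi s] on [[a, b]] with some [c > 0]
    ([k1_ge_Phi1], [k2_ge_Phi2]) and the positivity of [\int Phi g]. *)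

(** * Integrability of a power at the origin *)

Section powR_integrable.
Context {R : realType}.
Notation mu := (@lebesgue_measure R).

Lemma integral_powR_itv (a e : R) : 0 < a -> 0 < e < 1 ->
  (\int[mu]_(t in `[e, 1%R]) (t `^ (a - 1))%:E = ((1 - e `^ a) / a)%:E)%E.
Proof.
move=> a0 /andP[e0 e1].
have dF (x : R) : 0 < x -> is_derive x 1 (fun t : R => a^-1 * t `^ a) (x `^ (a - 1)).
  move=> x0; have d := is_derive1_powR a x0.
  apply: (is_derive_eq (is_deriveZ a^-1 d)).
  by rewrite /GRing.scale/= mulrA mulVf ?mul1r ?gt_eqF.
have cP (b x : R) : 0 < x -> {for x, continuous (fun t : R => t `^ b)}.
  move=> x0; apply: differentiable_continuous; apply/derivable1_diffP.
  by apply: derivable_powR; rewrite in_itv/= andbT.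
have cF (x : R) : 0 < x -> {for x, continuous (fun t : R => a^-1 * t `^ a)}.
  by move=> x0; apply: cvgM; [exact: cvg_cst|exact: cP].
rewrite (@continuous_FTC2 _ _ (fun t : R => a^-1 * t `^ a)) //.
- by rewrite -EFinB powR1 -mulrBr mulrC.
- apply: continuous_in_subspaceT => x; rewrite inE/= in_itv/= => /andP[ex _].
  exact/cP/(lt_le_trans e0).
- split => [x||].
  + rewrite in_itv/= => /andP[ex _].
    by case: (dF x (lt_trans e0 ex)).
  + exact/cvg_at_right_filter/cF.
  + exact/cvg_at_left_filter/cF.
- move=> x; rewrite in_itv/= => /andP[ex _].
  by rewrite derive1E; case: (dF x (lt_trans e0 ex)).
Qed.

(** [integral_powR_itv] bounds the integrals over the intervals [[e, 1]] by
    [1 / a] uniformly in [e]; monotone convergence lets [e] tend to 0. *)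
Lemma integrable_powR (a : R) : 0 < a ->
  mu.-integrable `]0, 1] (EFin \o (fun t : R => t `^ (a - 1))).
Proof.
move=> a0.
have mP (D : set R) : measurable_fun D (fun t : R => t `^ (a - 1)).
  by apply: measurable_funTS; exact: measurable_powR.
apply/integrableP; split; first by apply/measurable_EFinP; exact: mP.
under eq_integral => x _ do rewrite gee0_abs ?lee_fin ?powR_ge0//.
(* [i.+2] rather than [i.+1]: the fundamental theorem of calculus is applied on
   [[e, 1]] with [e < 1] strictly. *)
pose F (i : nat) : set R := `[i.+2%:R^-1, 1]%classic.
have F01 i : 0 < (i.+2%:R^-1 : R) < 1.
  by rewrite invr_gt0 ltr0n/= invf_lt1 ?ltr1n ?ltr0n.
have UF : \bigcup_i F i = `]0, 1]%classic.
  apply/seteqP; split=> [x [i _]|x]; rewrite /F /= !in_itv/=.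
    move=> /andP[ix ->]; rewrite andbT.
    by apply: lt_le_trans ix; case/andP: (F01 i).
  move=> /andP[x0 x1].
  have [i _ /(_ i (leqnn i)) /= ix] := near_infty_natSinv_lt (PosNum x0).
  exists i => //=; rewrite in_itv/= x1 andbT ltW//.
  by apply: le_lt_trans ix; rewrite lef_pV2 ?posrE ?ltr0n// ler_nat.
have ndF : nondecreasing_seq F.
  apply/nondecreasing_seqP => i; apply/subsetPset => x; rewrite /F/= !in_itv/=.
  move=> /andP[ix ->]; rewrite andbT (le_trans _ ix)//.
  by rewrite lef_pV2 ?posrE ?ltr0n// ler_nat.
have cvgI : (\int[mu]_(x in F i) (x `^ (a - 1))%:E)%E @[i --> \oo] -->
    (\int[mu]_(x in `]0%R, 1%R]) (x `^ (a - 1))%:E)%E.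
  rewrite -UF; apply: ge0_nondecreasing_set_cvg_integral => //.
  - by move=> i; exact: measurable_itv.
  - by move=> i; apply/measurable_EFinP; exact: mP.
  - by move=> i x _; rewrite lee_fin powR_ge0.
rewrite -(cvg_lim _ cvgI)//.
apply: (@le_lt_trans _ _ (a^-1)%:E); last exact: ltry.
apply: lime_le; first by apply/cvg_ex; eexists; exact: cvgI.
near=> i; rewrite integral_powR_itv// lee_fin ler_pdivrMr// mulVf ?gt_eqF//.
Unshelve. all: by end_near. Qed.
End powR_integrable.

(** * Integrability of the weight *)

Section weight.
Context {R : realType}.
Notation mu := (@lebesgue_measure R).
Variables (n : nat) (R1 : R) (h : R -> R).
Hypotheses (n3 : (3 <= n)%N) (R1_gt0 : 0 < R1) (hh : admissible n R1 h).

(** The decay of [h] is only assumed far out; on the remaining compact interval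
    [h] is bounded and the power is bounded below, so enlarging the constant
    makes the same decay hold on the whole half-line. *)
Lemma admissible_decay : exists2 m : R, 0 < m & exists2 C : R, 0 <= C &
  forall rho, R1 <= rho -> h rho <= C * rho `^ (- (n%:R + m)).
Proof.
have [ch _ [m m0 hdec]] := hh; exists m => //.
have [M [_ hM]] := hdec.
pose r0 := Num.max (M + 1) R1.
have [c cI hc] : exists2 c, c \in `[R1, r0] &
    forall t, t \in `[R1, r0] -> h t <= h c.
  apply: EVT_max; first by rewrite le_max lexx orbT.
  by apply: continuous_subspaceW ch => x /=; rewrite !in_itv/= andbT => /andP[].
have r00 : 0 < r0 by rewrite lt_max R1_gt0 orbT.
have nm0 : 0 <= n%:R + m by rewrite addr_ge0// ltW.
exists (Num.max 1 (h c * r0 `^ (n%:R + m))); first by rewrite le_max ler01.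
move=> rho R1rho; have rho0 : 0 < rho by rewrite (lt_le_trans R1_gt0).
have [rhor0|r0rho] := leP rho r0; last first.
  apply: (@le_trans _ _ (rho `^ (- (n%:R + m)))).
    apply: hM; apply: lt_trans r0rho.
    by rewrite lt_max ltrDl ltr01.
  by rewrite ler_peMl ?powR_ge0// le_max lexx.
apply: (@le_trans _ _ (h c * r0 `^ (n%:R + m) * rho `^ (- (n%:R + m)))); last first.
  by rewrite ler_wpM2r ?powR_ge0// le_max lexx orbT.
have hc0 : 0 <= h c by case: hh => _ + _; apply; move: cI; rewrite in_itv/= => /andP[].
rewrite -mulrA; apply: (@le_trans _ _ (h c)); first by apply: hc; rewrite in_itv/= R1rho.
rewrite ler_peMr// powRN ler_pdivlMr ?powR_gt0// mul1r.
by apply: ge0_ler_powR; rewrite ?nnegrE// ltW.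
Qed.

Lemma le_radius_of (t : R) : 0 < t <= 1 -> R1 <= radius_of n R1 t.
Proof.
move=> t01; rewrite /radius_of ler_peMr ?(ltW R1_gt0)//.
rewrite -[leLHS](powRr0 t) ger_powR// div1r invr_le0 subr_le0.
by rewrite ler_nat ltnW.
Qed.

(** At [t = 0] the weight vanishes, since 0 raised to a nonzero real exponent
    is 0; the sign condition on [h] says nothing about the radius 0 there. *)
Lemma weight_ge0 (t : R) : t \in `[0, 1] -> 0 <= weight n R1 h t.
Proof.
rewrite in_itv/= => /andP[]; rewrite le_eqVlt => /predU1P[<- _|t0 t1].
  rewrite /weight /phi powR0 ?mulr0 ?mul0r//.
  have n3R : 3 <= n%:R :> R by rewrite ler_nat.
  by rewrite mulf_neq0 ?invr_eq0//; apply/eqP; lra.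
rewrite /weight /phi; case: hh => _ h0 _.
have r1 : R1 <= radius_of n R1 t by rewrite le_radius_of ?t0.
apply: mulr_ge0; last exact: h0.
apply: mulr_ge0; first by rewrite (le_trans _ r1)// ltW.
apply: mulr_ge0; last exact: powR_ge0.
by rewrite divr_ge0 ?sqr_ge0// ltW.
Qed.

(** The powers of [t] contributed by the radius, by the factor in [phi] and by
    the decay of [h] add up to [m / (n - 2) - 1], where [m] is the decay margin
    of [h]: any [m > 0] puts the exponent above -1. *)
Lemma weight_le_powR : exists2 a : R, 0 < a & exists C : R,
  forall t, t \in `]0, 1] -> weight n R1 h t <= C * t `^ (a - 1).
Proof.
have [m m0 [C C0 hC]] := admissible_decay.
have n20 : 0 < n%:R - 2 :> R by rewrite subr_gt0 ltr_nat.
exists (m / (n%:R - 2)); first exact: divr_gt0.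
exists (R1 * (R1 / (n%:R - 2) ^+ 2) * (C * R1 `^ (- (n%:R + m)))) => t.
rewrite in_itv/= => t01; have /andP[t0 t1] := t01.
rewrite /weight; set r := radius_of _ _ _.
have r0 : 0 <= r by rewrite /r /radius_of mulr_ge0 ?powR_ge0// ltW.
apply: (@le_trans _ _ (phi n R1 t * (C * r `^ (- (n%:R + m))))).
  apply: ler_wpM2l; last exact/hC/le_radius_of.
  apply: mulr_ge0 => //; apply: mulr_ge0; last exact: powR_ge0.
  by rewrite divr_ge0 ?sqr_ge0// ltW.
rewrite /phi /r /radius_of powRM ?powR_ge0 ?(ltW R1_gt0)// -powRrM.
set p := 1 / _; set q := _ / (2 - _).
have -> : m / (n%:R - 2) - 1 = p + q + p * - (n%:R + m).
  by rewrite /p /q; field; rewrite -opprB oppr_eq0 gt_eqF.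
rewrite !powRD ?(gt_eqF t0) ?implybT//.
by rewrite le_eqVlt; apply/orP; left; apply/eqP; ring.
Qed.

Lemma measurable_weight : measurable_fun (`[0, 1]%classic : set R) (weight n R1 h).
Proof.
apply/measurable_fun_itv_obnd_cbndP.
have mr D : measurable_fun D (radius_of n R1).
  by apply: measurable_funTS; apply: measurable_funM.
apply: measurable_funM.
  apply: measurable_funM; first exact: mr.
  by apply: measurable_funM => //; apply: measurable_funTS.
apply: (measurable_comp (F := `[R1, +oo[%classic)) => //.
  move=> _ [t /= t01 <-]; rewrite in_itv/= andbT.
  by apply: le_radius_of; rewrite in_itv in t01.
by apply: subspace_continuous_measurable_fun => //; case: hh.
Qed.

Lemma integrable_weight : mu.-integrable `[0, 1] (EFin \o weight n R1 h).
Proof.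
have [a a0 [C hC]] := weight_le_powR.
have mw := measurable_weight.
have int : mu.-integrable `]0, 1] (EFin \o weight n R1 h).
  have mI : (R.-ocitv.-measurable).-sigma.-measurable `]0%R, 1%R]%classic.
    exact: measurable_itv.
  have iP := integrableZl mI C (integrable_powR a0).
  apply: le_integrable iP => //.
  - by apply/measurable_EFinP/measurable_fun_itv_obnd_cbndP.
  - move=> t t01; rewrite /= lee_fin ger0_norm.
      exact: le_trans (hC _ t01) (ler_norm _).
    by apply: weight_ge0; move: t01; rewrite /= !in_itv/= => /andP[/ltW -> ->].
apply/integrableP; split; first exact/measurable_EFinP.
rewrite -integral_itv_obnd_cbnd; first by case/integrableP: int.
apply: measurableT_comp => //.
by apply/measurable_EFinP/measurable_fun_itv_obnd_cbndP.
Qed.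
End weight.

(** * Suprema, minima and composition *)

Section sup_inf.
Context {R : realType}.
Implicit Types w : R -> R.

Definition bounded_on (a b : R) w : Prop :=
  exists B, forall t, t \in `[a, b] -> `|w t| <= B.

Lemma norm01_le w (B : R) :
  (forall t, t \in `[0, 1] -> `|w t| <= B) -> norm01 w <= B.
Proof.
move=> wB; apply: ge_sup.
  by exists `|w 0|; exists 0 => //=; rewrite in_itv/= lexx ler01.
by move=> _ [t /= t01 <-]; exact: wB.
Qed.

Lemma norm_le_norm01 w t : bounded_on 0 1 w ->
  t \in `[0, 1] -> `|w t| <= norm01 w.
Proof.
move=> [B wB] t01; apply: ub_le_sup; last by exists t.
by exists B => _ [s /= s01 <-]; exact: wB.
Qed.

(** A set that is unbounded above has supremum 0 by convention. *)
Lemma norm01_ge0 w : 0 <= norm01 w.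
Proof.
rewrite /norm01; set S := [set _ | _ in _].
have [hs|/sup_out->//] := pselect (has_sup S).
have [_ ub] := hs; apply: le_trans (normr_ge0 (w 0)) _; apply: ub_le_sup => //.
by exists 0 => //=; rewrite in_itv/= lexx ler01.
Qed.

Lemma min_on_le w (a b t : R) :
  bounded_on a b w ->
  t \in `[a, b] -> min_on a b w <= w t.
Proof.
move=> [B wB] tab; apply: ge_inf; last by exists t.
exists (- B) => _ [s /= sab <-].
by have := wB _ sab; rewrite ler_norml => /andP[].
Qed.

Lemma le_min_on w (a b B : R) : a <= b ->
  (forall t, t \in `[a, b] -> B <= w t) -> B <= min_on a b w.
Proof.
move=> ab wB; apply: lb_le_inf.
  by exists (w a); exists a => //=; rewrite in_itv/= lexx ab.
by move=> _ [t /= tab <-]; exact: wB.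
Qed.

Lemma continuous_bounded01 w : {within `[0, 1], continuous w} ->
  bounded_on 0 1 w.
Proof.
move=> cw.
have [c _ hc] := EVT_max ler01 cw; have [d _ hd] := EVT_min ler01 cw.
exists (Num.max (w c) (- w d)) => t t01.
by rewrite ler_norml lerNl !le_max lerN2 hd ?orbT// hc.
Qed.

(** The nonlinearity is continuous only within the half-plane [z1 >= 0], so the
    composition uses that the pair [(u, v)] stays in it. *)
Lemma continuous_nonlinearity (f : R * R -> R) (u v : R -> R) :
  {within [set z : R * R | 0 <= z.1], continuous f} ->
  {within `[0, 1], continuous u} -> {within `[0, 1], continuous v} ->
  (forall t, t \in `[0, 1] -> 0 <= u t) ->
  {within `[0, 1], continuous (fun s => f (u s, v s))}.
Proof.
move=> /subspace_continuousP cf /subspace_continuousP cu.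
move=> /subspace_continuousP cv u0; apply/subspace_continuousP => x x01.
have cuv : (u s, v s) @[s --> within `[0, 1] (nbhs x)] -->
    within [set z : R * R | 0 <= z.1] (nbhs (u x, v x)).
  have c : (u s, v s) @[s --> within `[0, 1] (nbhs x)] --> (u x, v x).
    have cux : u s @[s --> within `[0, 1] (nbhs x)] --> u x := cu x x01.
    have cvx : v s @[s --> within `[0, 1] (nbhs x)] --> v x := cv x x01.
    exact: cvg_pair cux cvx.
  move=> P hP; have : nbhs x (fun s => `[0, 1]%classic s ->
      0 <= u s -> P (u s, v s)) := c _ hP.
  by apply: filterS => s + s01; apply => //; exact: u0.
apply: cvg_trans (cf (u x, v x) (u0 x x01)).
by move=> P /=; exact: cuv.
Qed.
End sup_inf.

(** * The two Green's kernels *)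

Definition bounded_kernel (R : realType) (k : R -> R -> R) : Prop :=
  (forall t, measurable_fun setT (k t)) /\
  exists C, forall t s, t \in `[0, 1] -> s \in `[0, 1] -> `|k t s| <= C.

Section kernels.
Context {R : realType}.

Let measurable_green (t : R) :
  measurable_fun setT (fun s : R => if s <= t then t - s else 0).
Proof.
apply: measurable_fun_ifT => //; first exact: measurable_fun_ler.
exact: measurable_funB.
Qed.

Lemma green_bounded (t s : R) : t \in `[0, 1] -> s \in `[0, 1] ->
  `|if s <= t then t - s else 0| <= 1.
Proof.
rewrite !in_itv/= => /andP[t0 t1] /andP[s0 s1].
by case: ifPn; rewrite ?normr0 ?ler01// => st; rewrite ler_norml; lra.
Qed.

Section k1.
Variables (beta1 eta : R).
Hypotheses (heta : 0 < eta < 1) (hbeta1 : 1 <= beta1 < 1 / eta).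

Lemma k1_denominator_gt0 : 0 < 1 - beta1 * eta.
Proof.
by case/andP: heta hbeta1 => e0 _ /andP[_]; rewrite ltr_pdivlMr// subr_gt0.
Qed.
Let D0 := k1_denominator_gt0.

Lemma bounded_k1 : bounded_kernel (k1 beta1 eta).
Proof.
case/andP: heta hbeta1 => e0 e1 /andP[b1 _]; split=> [t|].
  apply: measurable_funB => //; apply: measurable_funB.
    apply: measurable_funM => //; apply: measurable_funM => //.
    exact: measurable_funB.
  apply: measurable_fun_ifT => //; first exact: measurable_fun_ler.
  apply: measurable_funM => //; apply: measurable_funM => //.
  exact: measurable_funB.
exists ((1 - beta1 * eta)^-1 + beta1 / (1 - beta1 * eta) + 1) => t s ht hs.
rewrite (le_trans (ler_normB _ _))// lerD ?green_bounded//.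
move: ht hs; rewrite !in_itv/= => /andP[t0 t1] /andP[s0 s1].
have Di0 : 0 <= (1 - beta1 * eta)^-1 by rewrite invr_ge0 ltW.
rewrite (le_trans (ler_normB _ _))// lerD//.
  rewrite normrM (ger0_norm Di0) -[leRHS]mul1r ler_wpM2r// ger0_norm; nra.
case: ifPn => se; last by rewrite normr0 divr_ge0// ltW//; lra.
rewrite normrM (ger0_norm Di0) ler_wpM2r// ger0_norm; last first.
  by rewrite !mulr_ge0//; lra.
rewrite -mulrA ler_piMr//; [lra|nra].
Qed.

(** Multiplied by the denominator [D = 1 - beta1 eta], the kernel is in each
    of the four regions a sum of nonnegative terms, one of which dominates a
    positive multiple of [s (1 - s)].  Each of these multiples is a product of
    some of [a], [eta] and [D], which are at most 1, so the product of all three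
    serves everywhere; dividing by [beta1] absorbs the factor in [Phi1]. *)
Lemma k1_ge_Phi1 (a b : R) : 0 < a -> b <= 1 -> exists2 c, 0 < c &
  forall t s, t \in `[a, b] -> s \in `[0, 1] ->
    c * Phi1 beta1 eta s <= k1 beta1 eta t s.
Proof.
move=> a0 ble; case/andP: heta hbeta1 => e0 e1 /andP[b1 _].
have bne : beta1 != 0 by apply/eqP; lra.
have Dne : 1 - beta1 * eta != 0 by rewrite gt_eqF.
exists (a * eta * (1 - beta1 * eta) / beta1).
  by rewrite divr_gt0// ?mulr_gt0//; lra.
move=> t s; rewrite !in_itv/= => /andP[at_ tb] /andP[s0 s1].
have -> : a * eta * (1 - beta1 * eta) / beta1 * Phi1 beta1 eta s =
  (a * eta * (1 - beta1 * eta) * (s * (1 - s))) / (1 - beta1 * eta).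
  by rewrite /Phi1; field; apply/andP.
have -> : k1 beta1 eta t s = (t * (1 - s)
   - (if s <= eta then beta1 * t * (eta - s) else 0)
   - (if s <= t then (t - s) * (1 - beta1 * eta) else 0)) / (1 - beta1 * eta).
  by rewrite /k1; case: ifP => _; case: ifP => _; field.
rewrite ler_pM2r ?invr_gt0//.
have t1 : t <= 1 by lra.
have D1 : 1 - beta1 * eta <= 1 by nra.
have a1le : a <= 1 by lra.
have ss0 : 0 <= s * (1 - s) by nra.
have ae1 : a * eta <= 1 by nra.
have ae0 : 0 <= a * eta by nra.
have Dp := D0; set D := 1 - beta1 * eta in Dp D1 *.
have bs0 : 0 <= (beta1 - 1) * s by nra.
have bt0 : 0 <= (beta1 - 1) * t by nra.
case: ifPn => se; case: ifPn => st.
- have -> : t * (1 - s) - beta1 * t * (eta - s) - (t - s) * D =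
    s * D + (beta1 - 1) * t * s by rewrite /D; ring.
  have : a * eta * (s * (1 - s)) <= s by nra.
  nra.
- have -> : t * (1 - s) - beta1 * t * (eta - s) - 0 =
    t * D + (beta1 - 1) * s * t by rewrite /D; ring.
  have : a * eta * (s * (1 - s)) <= t by nra.
  nra.
- have -> : t * (1 - s) - 0 - (t - s) * D =
    eta * (s * (1 - s)) + (1 - eta) * (s * (1 - t)) +
    eta * ((t - s) * (beta1 - s)) by rewrite /D; ring.
  have es0 : 0 <= eta * (s * (1 - s)) by rewrite mulr_ge0//; lra.
  have aD1 : a * D <= 1 by nra.
  have : a * D * (eta * (s * (1 - s))) <= eta * (s * (1 - s)).
    by rewrite ler_piMl.
  have : 0 <= (1 - eta) * (s * (1 - t)) by rewrite !mulr_ge0//; lra.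
  have : 0 <= eta * ((t - s) * (beta1 - s)) by rewrite !mulr_ge0//; lra.
  lra.
- have eD1 : eta * D <= 1 by nra.
  have ass0 : 0 <= a * (s * (1 - s)) by rewrite mulr_ge0//; lra.
  have : a * (s * (1 - s)) <= t * (1 - s) by nra.
  have : eta * D * (a * (s * (1 - s))) <= a * (s * (1 - s)).
    by rewrite ler_piMl.
  lra.
Qed.

Lemma Phi1_ge0 s : s \in `[0, 1] -> 0 <= Phi1 beta1 eta s.
Proof.
rewrite in_itv/= => /andP[s0 s1]; case/andP: hbeta1 => b1 _.
by rewrite /Phi1 divr_ge0 ?(ltW D0)// !mulr_ge0//; lra.
Qed.

Lemma measurable_Phi1 : measurable_fun setT (Phi1 beta1 eta).
Proof.
apply: measurable_funM => //; apply: measurable_funM => //.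
exact: measurable_funB.
Qed.

Lemma gamma1_bounded : bounded_on 0 1 (gamma1 beta1 eta).
Proof.
exists (1 + (beta1 - 1) / (1 - beta1 * eta)) => t; rewrite in_itv/= => /andP[t0 t1].
have /andP[b1 _] := hbeta1.
have b0 : 0 <= (beta1 - 1) / (1 - beta1 * eta).
  by rewrite divr_ge0 ?(ltW D0) ?subr_ge0.
rewrite /gamma1 mulrAC (le_trans (ler_normD _ _))// normr1 lerD2l.
by rewrite ger0_norm ?(mulr_ge0 b0)// ler_piMr.
Qed.

(** [beta1 (1 - eta) / (1 - beta1 eta)] is the value of the nondecreasing
    function [gamma1] at 1, that is, its norm. *)
Lemma gamma1_ge (a t : R) : a <= t ->
  cgamma1 beta1 eta a * (beta1 * (1 - eta) / (1 - beta1 * eta)) <=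
  gamma1 beta1 eta t.
Proof.
move=> at_; case/andP: heta hbeta1 => e0 e1 /andP[b1 _].
have -> : gamma1 beta1 eta t =
    (1 - beta1 * eta + (beta1 - 1) * t) / (1 - beta1 * eta).
  by rewrite /gamma1; field; rewrite gt_eqF.
have -> : cgamma1 beta1 eta a * (beta1 * (1 - eta) / (1 - beta1 * eta)) =
    (1 - beta1 * eta + (beta1 - 1) * a) / (1 - beta1 * eta).
  rewrite /cgamma1; field; rewrite (gt_eqF D0)/=; apply/andP; split.
    by apply/eqP; lra.
  by apply/eqP; lra.
by rewrite ler_pM2r ?invr_gt0//; nra.
Qed.

Lemma cgamma1_gt0 (a : R) : 0 < a -> 0 < cgamma1 beta1 eta a.
Proof.
move=> a0; case/andP: heta hbeta1 => e0 e1 /andP[b1 _].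
have d0 : 0 < beta1 * (1 - eta) by rewrite mulr_gt0//; lra.
rewrite /cgamma1 ltr_wpDl ?divr_gt0// mulr_ge0 ?(ltW a0)//.
by rewrite divr_ge0 ?(ltW d0)// subr_ge0.
Qed.

Lemma cgamma1_norm_le (a t : R) : 0 < a -> a <= t ->
  cgamma1 beta1 eta a * norm01 (gamma1 beta1 eta) <= gamma1 beta1 eta t.
Proof.
move=> a0 at_; apply: le_trans (gamma1_ge at_).
rewrite ler_wpM2l ?(ltW (cgamma1_gt0 a0))//; apply: norm01_le => s.
rewrite in_itv/= => /andP[s0 s1]; case/andP: heta hbeta1 => e0 e1 /andP[b1 _].
have -> : gamma1 beta1 eta s =
    (1 - beta1 * eta + (beta1 - 1) * s) / (1 - beta1 * eta).
  by rewrite /gamma1; field; rewrite gt_eqF.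
have N0 : 0 <= (beta1 - 1) * s by rewrite mulr_ge0//; lra.
rewrite ger0_norm; last by rewrite divr_ge0 ?(ltW D0)// addr_ge0// ltW.
by rewrite ler_pM2r ?invr_gt0//; nra.
Qed.

Lemma ck1_gt0 (a : R) : 0 < a -> 0 < ck1 beta1 eta a.
Proof.
move=> a0; case/andP: heta => e0 _.
by rewrite /ck1 !lt_min !mulr_gt0.
Qed.
End k1.

Section k2.
Variables (beta2 xi : R).
Hypotheses (hxi : 0 < xi < 1) (hbeta2 : 0 <= beta2 < 1 - xi).

Lemma k2_denominator_gt0 : 0 < 1 - beta2.
Proof. by case/andP: hxi hbeta2 => ? ? /andP[? ?]; lra. Qed.
Let D0 := k2_denominator_gt0.

Lemma bounded_k2 : bounded_kernel (k2 beta2 xi).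
Proof.
case/andP: hxi hbeta2 => x0 x1 /andP[b0 b1]; split=> [t|].
  apply: measurable_funB => //; apply: measurable_funB.
    apply: measurable_funM => //; apply: measurable_funM => //.
    exact: measurable_funB.
  by apply: measurable_fun_ifT => //; exact: measurable_fun_ler.
exists ((1 - beta2)^-1 + beta2 / (1 - beta2) + 1) => t s ht hs.
rewrite (le_trans (ler_normB _ _))// lerD ?green_bounded//.
move: ht hs; rewrite !in_itv/= => /andP[t0 t1] /andP[s0 s1].
have Di0 : 0 <= (1 - beta2)^-1 by rewrite invr_ge0 ltW.
rewrite (le_trans (ler_normB _ _))// lerD//.
  rewrite normrM (ger0_norm Di0) -[leRHS]mul1r ler_wpM2r// ger0_norm; nra.
case: ifPn => se; last by rewrite normr0 divr_ge0// ltW//; lra.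
rewrite normrM (ger0_norm Di0) ler_wpM2r// ger0_norm; nra.
Qed.

(** Same mechanism as for [k1_ge_Phi1].  Here [t <= b < 1 - beta2] is what
    keeps [s (1 - beta2 - t)] nonnegative in the region [s <= xi], [s <= t]: for
    [t > 1 - beta2] the kernel is negative at small [s > 0]. *)
Lemma k2_ge_Phi2 (a b : R) : 0 < a -> b < 1 - beta2 -> exists2 c, 0 < c &
  forall t s, t \in `[a, b] -> s \in `[0, 1] ->
    c * Phi2 beta2 xi s <= k2 beta2 xi t s.
Proof.
move=> a0 blt; case/andP: hxi hbeta2 => x0 x1 /andP[be0 be1].
set mx := Num.max 1 (beta2 / xi).
have mx0 : 0 < mx by rewrite lt_max ltr01.
have mxne : mx != 0 by rewrite gt_eqF.
have Dne : 1 - beta2 != 0 by rewrite gt_eqF.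
have [ab|ba] := leP a b; last first.
  exists 1 => // t s; rewrite in_itv/= => /andP[at_ tb]; lra.
set p := 1 - beta2 - b; set q := 1 - beta2 - xi.
have p0 : 0 < p by rewrite /p; lra.
have q0 : 0 < q by rewrite /q; lra.
exists (a * p * q / mx).
  by rewrite divr_gt0// !mulr_gt0.
move=> t s; rewrite !in_itv/= => /andP[at_ tb] /andP[s0 s1].
have -> : a * p * q / mx * Phi2 beta2 xi s =
  (a * p * q * (s * (1 - s))) / (1 - beta2).
  by rewrite /Phi2 -/mx; field; apply/andP.
have -> : k2 beta2 xi t s = (t * (1 - s)
   - (if s <= xi then beta2 * t else 0)
   - (if s <= t then (t - s) * (1 - beta2) else 0)) / (1 - beta2).
  by rewrite /k2; case: ifP => _; case: ifP => _; field.
rewrite ler_pM2r ?invr_gt0//.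
have ss0 : 0 <= s * (1 - s) by nra.
have p1 : p <= 1 by rewrite /p; lra.
have q1 : q <= 1 by rewrite /q; lra.
have ale : a <= 1 by lra.
have pq1 : p * q <= 1 by nra.
have aq1 : a * q <= 1 by nra.
have p_le : p <= 1 - beta2 - t by rewrite /p; lra.
case: ifPn => se; case: ifPn => st.
- have -> : t * (1 - s) - beta2 * t - (t - s) * (1 - beta2) =
    s * (1 - beta2 - t) by ring.
  have : a * q * (s * (1 - s)) <= s by nra.
  nra.
- have -> : t * (1 - s) - beta2 * t - 0 = t * (1 - s - beta2) by ring.
  have pss1 : p * (s * (1 - s)) <= 1 by nra.
  have aq0 : 0 <= a * q by rewrite mulr_ge0// ltW.
  have : a * q * (p * (s * (1 - s))) <= a * q by rewrite ler_piMr.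
  have : a * q <= t * (1 - s - beta2).
    by apply: ler_pM => //; [exact: ltW|exact: ltW|rewrite /q; lra].
  lra.
- have -> : t * (1 - s) - 0 - (t - s) * (1 - beta2) =
    s * (1 - t) + beta2 * (t - s) by ring.
  have : 0 <= beta2 * (t - s) by rewrite mulr_ge0//; lra.
  have : p * (s * (1 - s)) <= s * (1 - t).
    rewrite mulrCA ler_wpM2l// (@le_trans _ _ p)//; last by rewrite /p; lra.
    by rewrite ler_piMr ?(ltW p0)//; lra.
  have pss0 : 0 <= p * (s * (1 - s)) by rewrite mulr_ge0// ltW.
  have : a * q * (p * (s * (1 - s))) <= p * (s * (1 - s)) by rewrite ler_piMl.
  lra.
- have : a * (s * (1 - s)) <= t * (1 - s).
    rewrite mulrA ler_wpM2r//; first by lra.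
    by rewrite (le_trans _ at_)// ler_piMr// ltW.
  have ass0 : 0 <= a * (s * (1 - s)) by rewrite mulr_ge0// ltW.
  have : p * q * (a * (s * (1 - s))) <= a * (s * (1 - s)) by rewrite ler_piMl.
  lra.
Qed.

Lemma Phi2_ge0 s : s \in `[0, 1] -> 0 <= Phi2 beta2 xi s.
Proof.
rewrite in_itv/= => /andP[s0 s1].
apply: mulr_ge0; first by rewrite le_max ler01.
by rewrite divr_ge0 ?(ltW D0)// !mulr_ge0//; lra.
Qed.

Lemma measurable_Phi2 : measurable_fun setT (Phi2 beta2 xi).
Proof.
do 3 apply: measurable_funM => //.
exact: measurable_funB.
Qed.

Lemma gamma2_bounded : bounded_on 0 1 (gamma2 beta2).
Proof.
exists (1 + (1 - beta2)^-1) => t; rewrite in_itv/= => /andP[t0 t1].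
have Di0 : 0 <= (1 - beta2)^-1 by rewrite invr_ge0 ltW.
rewrite (le_trans (ler_normB _ _))// normr1 lerD2l ger0_norm ?mulr_ge0//.
by rewrite ler_piMl.
Qed.

Lemma cgamma2_gt0 (b : R) : b < 1 - beta2 -> 0 < cgamma2 beta2 b.
Proof.
move=> blt; rewrite /cgamma2; case: ifPn => hb.
  by rewrite -mulrBl divr_gt0//; lra.
by rewrite subr_gt0 ltr_pdivrMr// mul1r.
Qed.

Lemma cgamma2_norm_le (b t : R) : b < 1 - beta2 -> t <= b ->
  cgamma2 beta2 b * norm01 (gamma2 beta2) <= gamma2 beta2 t.
Proof.
move=> blt tb; have Dne : 1 - beta2 != 0 by rewrite gt_eqF.
have Di0 : 0 <= (1 - beta2)^-1 by rewrite invr_ge0 ltW.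
have gE s : gamma2 beta2 s = (1 - beta2 - s) / (1 - beta2).
  by rewrite /gamma2; field.
apply: (@le_trans _ _ (gamma2 beta2 b)); last first.
  by rewrite !gE ler_wpM2r//; lra.
have /andP[be0 be1] := hbeta2.
(* [gamma2] decreases from 1 to [- beta2 / (1 - beta2)], so its norm is the
   larger of the two absolute values; they swap order at [beta2 = 1 / 2]. *)
pose N := if 1 / 2 <= beta2 then beta2 / (1 - beta2) else 1.
have cN : cgamma2 beta2 b * N = gamma2 beta2 b.
  rewrite /cgamma2 /N gE; case: ifPn => hb; field => //.
  by rewrite Dne; apply/eqP; lra.
rewrite -cN ler_wpM2l ?(ltW (cgamma2_gt0 blt))//; apply: norm01_le => s.
rewrite in_itv/= => /andP[s0 s1].
rewrite gE normrM (ger0_norm Di0) /N; case: ifPn => hb.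
  by rewrite ler_wpM2r// ler_norml; lra.
by rewrite -/(_ / _) ler_pdivrMr// mul1r ler_norml; lra.
Qed.

Lemma ck2_gt0 (a b : R) : 0 < a -> b < 1 - beta2 -> 0 < ck2 beta2 xi a b.
Proof.
move=> a0 blt; have /andP[be0 be1] := hbeta2.
rewrite /ck2 divr_gt0// ?lt_min ?lt_max ?ltr01//.
by rewrite mulr_gt0 ?mulr_gt0//=; lra.
Qed.
End k2.
End kernels.

(** * Comparison of a solution with its own norm *)

Section operator.
Context {R : realType}.
Notation mu := (@lebesgue_measure R).
Variables (k : R -> R -> R) (g : R -> R).
Hypothesis bk : bounded_kernel k.
Hypothesis g0 : forall s, s \in `[0, 1] -> 0 <= g s.
Hypothesis ig : mu.-integrable `[0, 1] (EFin \o g).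

Lemma integrable_mul_weight (q : R -> R) :
  measurable_fun (`[0, 1]%classic : set R) q ->
  bounded_on 0 1 q ->
  mu.-integrable `[0, 1] (EFin \o (fun s => q s * g s)).
Proof.
move=> mq [C qC].
have bq : [bounded q x | x in (`[0, 1]%classic : set R)].
  exists C; split; first exact: num_real.
  by move=> y /ltW Cy x /= x01; apply: le_trans Cy; exact: qC.
have iqg : mu.-integrable `[0, 1] ((EFin \o q) \* (EFin \o g))%E.
  exact: integrableMr.
by apply: eq_integrable iqg => // s _; rewrite /= EFinM.
Qed.

Lemma integrable_kernel t : t \in `[0, 1] ->
  mu.-integrable `[0, 1] (EFin \o (fun s => k t s * g s)).
Proof.
move=> t01; have [mk [C kC]] := bk; apply: integrable_mul_weight.
  exact: measurable_funTS.
by exists C => s; exact: kC.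
Qed.

Lemma integrable_abs_kernel t : t \in `[0, 1] ->
  mu.-integrable `[0, 1] (EFin \o (fun s => `|k t s| * g s)).
Proof.
move=> t01; have [mk [C kC]] := bk; apply: integrable_mul_weight.
  by apply: measurable_funTS; apply: measurableT_comp.
by exists C => s s01; rewrite normr_id kC.
Qed.

Lemma integrable_kernel_mul (F : R -> R) t : t \in `[0, 1] ->
  {within `[0, 1], continuous F} ->
  mu.-integrable `[0, 1] (EFin \o (fun s => k t s * g s * F s)).
Proof.
move=> t01 cF; have [mk [C kC]] := bk; have [D FD] := continuous_bounded01 cF.
have -> : (fun s => k t s * g s * F s) = (fun s => k t s * F s * g s).
  by apply/funext => s; rewrite mulrAC.
apply: integrable_mul_weight.
  apply: measurable_funM; first exact: measurable_funTS.
  exact: subspace_continuous_measurable_fun.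
by exists (C * D) => s s01; rewrite normrM ler_pM// ?kC// FD.
Qed.

Lemma m_const_ge0 : 0 <= m_const k g.
Proof.
rewrite /m_const invr_ge0; set S := [set _ | _ in _].
have [hs|/sup_out->//] := pselect (has_sup S).
have [[x Sx] ub] := hs; apply: le_trans (ub_le_sup ub Sx).
case: Sx => t _ <-; apply: Rintegral_ge0 => s s01.
by rewrite mulr_ge0// g0.
Qed.

(** The integrals [\int |k t s| g s] are bounded uniformly in [t], so their
    supremum is a genuine one.  If it is 0, its inverse is 0 and the bound is
    trivial. *)
Lemma m_const_integral_le1 t : t \in `[0, 1] ->
  m_const k g * \int[mu]_(s in `[0%R, 1%R]) (`|k t s| * g s) <= 1.
Proof.
move=> t01; have [mk [C kC]] := bk; rewrite /m_const.
set S := [set _ | _ in _].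
have I0 t' : 0 <= \int[mu]_(s in `[0%R, 1%R]) (`|k t' s| * g s).
  by apply: Rintegral_ge0 => s s01; rewrite mulr_ge0// g0.
have ubS : has_ubound S.
  exists (\int[mu]_(s in `[0%R, 1%R]) (C * g s)) => _ [t' /= t'01 <-].
  apply: le_Rintegral => //.
  - exact: integrable_abs_kernel.
  - apply: integrable_mul_weight; first exact: measurable_cst.
    by exists `|C|.
  - by move=> s s01; rewrite ler_wpM2r ?g0// kC.
have IS : \int[mu]_(s in `[0%R, 1%R]) (`|k t s| * g s) <= sup S.
  by apply: ub_le_sup => //; exists t.
have [S0|S0] := eqVneq (sup S) 0; first by rewrite S0 invr0 mul0r.
rewrite mulrC ler_pdivrMr ?mul1r// lt_neqAle eq_sym S0/=.
exact: le_trans (I0 t) IS.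
Qed.

(** The upper comparison: the right-hand side is at most
    [(norm01 gam * A + lambda) * norm01 w] pointwise. *)
Lemma norm01_le0_small (gam w F : R -> R) (A lambda H : R) :
  bounded_on 0 1 gam ->
  0 < lambda ->
  bounded_on 0 1 w ->
  {within `[0, 1], continuous F} -> (forall s, s \in `[0, 1] -> 0 <= F s) ->
  (forall s, s \in `[0, 1] -> F s <= lambda * m_const k g * `|w s|) ->
  0 <= H <= A * norm01 w ->
  (forall t, t \in `[0, 1] -> w t =
    gam t * H + \int[mu]_(s in `[0%R, 1%R]) (k t s * g s * F s)) ->
  norm01 gam * A + lambda < 1 -> norm01 w <= 0.
Proof.
move=> gB l0 wB cF F0 Fl /andP[H0 HA] we small.
have W0 := norm01_ge0 w; have m0 := m_const_ge0.
suff : norm01 w <= (norm01 gam * A + lambda) * norm01 w by nra.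
apply: norm01_le => t t01; rewrite we// mulrDl.
apply: (le_trans (ler_normD _ _)); apply: lerD.
  rewrite normrM (ger0_norm H0) -mulrA; apply: ler_pM => //.
  exact: norm_le_norm01.
have ikF := integrable_kernel_mul t01 cF.
have iak := integrable_abs_kernel t01.
pose L := lambda * m_const k g * norm01 w.
apply: (le_trans (le_normr_Rintegral _ _)) => //.
apply: (@le_trans _ _ (\int[mu]_(s in `[0%R, 1%R]) (`|k t s| * g s * L))).
  apply: le_Rintegral => //.
  - exact: integrable_norm.
  - exact: (integrableZr _ L iak).
  - move=> s s01; rewrite !normrM (ger0_norm (g0 s01)) (ger0_norm (F0 s s01)).
    rewrite ler_wpM2l ?mulr_ge0 ?g0//; apply: le_trans (Fl _ s01) _.
    by rewrite ler_wpM2l ?mulr_ge0 ?(ltW l0)// norm_le_norm01.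
rewrite RintegralZr// mulrC /L.
have -> : lambda * m_const k g * norm01 w *
    \int[mu]_(s in `[0%R, 1%R]) (`|k t s| * g s) =
  lambda * norm01 w * (m_const k g *
    \int[mu]_(s in `[0%R, 1%R]) (`|k t s| * g s)) by ring.
by rewrite ler_piMr ?m_const_integral_le1// mulr_ge0// ltW.
Qed.

Section subinterval.
Variables (a b : R).
Hypotheses (a0 : 0 <= a) (ab : a <= b) (b1 : b <= 1).

Lemma sub_itv01 t : t \in `[a, b] -> t \in `[0, 1].
Proof.
by rewrite !in_itv/= => /andP[at_ tb]; rewrite (le_trans a0 at_) (le_trans tb b1).
Qed.

Lemma integrable_sub (F : R -> R) : mu.-integrable `[0, 1] (EFin \o F) ->
  mu.-integrable `[a, b] (EFin \o F).
Proof. by apply: integrableS => // t; exact: sub_itv01. Qed.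

Lemma le_Rintegral_sub (F : R -> R) : mu.-integrable `[0, 1] (EFin \o F) ->
  (forall s, s \in `[0, 1] -> 0 <= F s) ->
  \int[mu]_(s in `[a, b]) F s <= \int[mu]_(s in `[0%R, 1%R]) F s.
Proof.
move=> iF F0; rewrite /Rintegral fine_le//.
- exact/integrable_fin_num/integrable_sub.
- exact: integrable_fin_num.
apply: ge0_subset_integral => //.
- by case/integrableP: iF.
- by move=> t; exact: sub_itv01.
Qed.

Variable Phi : R -> R.
Hypothesis mPhi : measurable_fun setT Phi.
Hypothesis Phi0 : forall s, s \in `[0, 1] -> 0 <= Phi s.
Hypothesis kPhi : exists2 c, 0 < c &
  forall t s, t \in `[a, b] -> s \in `[0, 1] -> c * Phi s <= k t s.
Hypothesis intPhi : 0 < \int[mu]_(s in `[a, b]) (Phi s * g s).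

Lemma kernel_ge0 t s : t \in `[a, b] -> s \in `[0, 1] -> 0 <= k t s.
Proof.
move=> tab s01; have [c c0 ck] := kPhi.
by apply: le_trans (ck t s tab s01); rewrite mulr_ge0 ?Phi0// ltW.
Qed.

(** Without strict positivity the inverse [M_const] could be 0, and the growth
    condition on the nonlinearity would carry no information. *)
Lemma inf_kernel_gt0 :
  0 < inf [set \int[mu]_(s in `[a, b]) (k t s * g s) | t in `[a, b]].
Proof.
have aab : a \in `[a, b] by rewrite in_itv/= lexx ab.
have [c c0 ck] := kPhi; have [mk [C kC]] := bk.
have iPhi : mu.-integrable `[a, b] (EFin \o (fun s => Phi s * g s)).
  apply: integrable_sub; apply: integrable_mul_weight.
    exact: measurable_funTS.
  exists (C / c) => s s01; rewrite ger0_norm ?Phi0// ler_pdivlMr// mulrC.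
  apply: le_trans (ck a s aab s01) _; apply: le_trans (ler_norm _) _.
  exact/kC/s01/sub_itv01.
apply: (@lt_le_trans _ _ (c * \int[mu]_(s in `[a, b]) (Phi s * g s))).
  exact: mulr_gt0.
apply: lb_le_inf; first by exists (\int[mu]_(s in `[a, b]) (k a s * g s)); exists a.
move=> _ [t /= tab <-]; rewrite -RintegralZl//; apply: le_Rintegral => //.
- have mI : (R.-ocitv.-measurable).-sigma.-measurable `[a, b]%classic.
    exact: measurable_itv.
  have := integrableZl mI c iPhi.
  by apply: eq_integrable => // s _; rewrite /= EFinM.
- exact/integrable_sub/integrable_kernel/sub_itv01.
- move=> s sab; rewrite mulrA ler_wpM2r ?g0 ?sub_itv01//.
  by apply: ck => //; exact: sub_itv01.
Qed.

Lemma M_const_gt0 : 0 < M_const k g a b.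
Proof. by rewrite invr_gt0 inf_kernel_gt0. Qed.

Lemma M_const_integral_ge1 t : t \in `[a, b] ->
  1 <= M_const k g a b * \int[mu]_(s in `[a, b]) (k t s * g s).
Proof.
move=> tab; rewrite /M_const mulrC ler_pdivlMr ?inf_kernel_gt0// mul1r.
apply: ge_inf; last by exists t.
exists 0 => _ [t' /= t'ab <-]; apply: Rintegral_ge0 => s sab.
by rewrite mulr_ge0 ?kernel_ge0 ?g0 ?sub_itv01.
Qed.

(** The lower comparison: the minimum [sigma] of [w] over [[a, b]] reproduces
    itself with a factor larger than 1. *)
Lemma norm01_le0_large (gam w F : R -> R) (cg c A lambda H : R) :
  (forall t, t \in `[a, b] -> cg * norm01 gam <= gam t) ->
  0 < cg -> 0 < c -> 0 < A -> 0 < lambda ->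
  bounded_on 0 1 w ->
  c * norm01 w <= min_on a b w ->
  {within `[0, 1], continuous F} -> (forall s, s \in `[0, 1] -> 0 <= F s) ->
  (forall s, s \in `[0, 1] -> lambda * M_const k g a b * w s <= F s) ->
  A * norm01 w <= H ->
  (forall t, t \in `[0, 1] -> w t =
    gam t * H + \int[mu]_(s in `[0%R, 1%R]) (k t s * g s * F s)) ->
  1 < cg * norm01 gam * A + lambda -> norm01 w <= 0.
Proof.
move=> gamge cg0 c0 A0 l0 wB cw cF F0 lF HA we large.
have aab : a \in `[a, b] by rewrite in_itv/= lexx ab.
set sigma := min_on a b w.
have wBab : bounded_on a b w.
  by have [B hB] := wB; exists B => t /sub_itv01; exact: hB.
have W0 := norm01_ge0 w.
have sigma0 : 0 <= sigma by apply: le_trans cw; rewrite mulr_ge0// ltW.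
have M0 := M_const_gt0.
have key t : t \in `[a, b] ->
    cg * norm01 gam * A * norm01 w + lambda * sigma <= w t.
  move=> tab; have t01 := sub_itv01 tab; rewrite we//; apply: lerD.
    rewrite -mulrA; apply: ler_pM => //; last exact: gamge.
      by rewrite mulr_ge0 ?norm01_ge0// ltW.
    by rewrite mulr_ge0// ltW.
  have ikF := integrable_kernel_mul t01 cF.
  apply: (@le_trans _ _ (\int[mu]_(s in `[a, b]) (k t s * g s * F s))); last first.
    apply: le_Rintegral_sub => // s s01.
    by rewrite !mulr_ge0 ?kernel_ge0 ?g0 ?F0.
  pose L := lambda * M_const k g a b * sigma.
  have L0 : 0 <= lambda * M_const k g a b by rewrite mulr_ge0// ltW.
  have ik := integrable_sub (integrable_kernel t01).
  apply: (@le_trans _ _ (\int[mu]_(s in `[a, b]) (k t s * g s * L))).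
    rewrite RintegralZr// [leRHS]mulrC /L.
    set I := Rintegral _ _ _.
    have MI : 1 <= M_const k g a b * I := M_const_integral_ge1 tab.
    have -> : lambda * M_const k g a b * sigma * I =
      lambda * sigma * (M_const k g a b * I) by ring.
    by rewrite ler_peMr// mulr_ge0// ltW.
  apply: le_Rintegral => //.
  - exact: (integrableZr _ L ik).
  - exact: integrable_sub.
  - move=> s sab; have s01 := sub_itv01 sab.
    rewrite ler_wpM2l ?mulr_ge0 ?kernel_ge0 ?g0//.
    by apply: le_trans (lF _ s01); rewrite ler_wpM2l// min_on_le.
(* [key] involves both [norm01 w] and [sigma]; bounding the former below by
   the latter leaves an inequality in [sigma] alone. *)
have sw : sigma <= norm01 w.
  apply: le_trans (min_on_le wBab aab) _; apply: le_trans (ler_norm _) _.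
  by apply: norm_le_norm01 => //; exact: sub_itv01.
have := le_min_on ab key; rewrite -/sigma => key'.
have n0 := norm01_ge0 gam.
have K0 : 0 <= cg * norm01 gam * A by rewrite !mulr_ge0// ltW.
have : sigma <= 0 by nra.
move=> s0; have : c * norm01 w <= 0 by exact: le_trans cw s0.
by rewrite pmulr_rle0.
Qed.
End subinterval.

End operator.

Theorem theorem2p14 (R : realType) (n : nat)
    (R1 Reta Rxi beta1 delta1 eta xi beta2 a1 b1 a2 b2 : R)
    (h1 h2 : R -> R) (f1 f2 : R * R -> R)
    (H1 H2 : fun01 R * fun01 R -> R) (A1 A2 lambda1 lambda2 : R)
    (hn : (3 <= n)%N) (hR1 : 0 < R1) (hReta : R1 < Reta) (hRxi : R1 < Rxi)
    (heta : 0 < eta < 1) (hxi : 0 < xi < 1)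
    (hrad_eta : radius_of n R1 eta = Reta) (hrad_xi : radius_of n R1 xi = Rxi)
    (hbeta2_def : beta2 = (2 - n%:R) * delta1 * (xi / Rxi))
    (hbeta1 : 1 <= beta1 < 1 / eta) (hbeta2 : 0 <= beta2 < 1 - xi)
    (hf1_cont : {within [set z : R * R | 0 <= z.1], continuous f1})
    (hf2_cont : {within [set z : R * R | 0 <= z.1], continuous f2})
    (hf1_ge0 : forall z1 z2, 0 <= z1 -> 0 <= f1 (z1, z2))
    (hf2_ge0 : forall z1 z2, 0 <= z1 -> 0 <= f2 (z1, z2))
    (hh1 : admissible n R1 h1) (hh2 : admissible n R1 h2)
    (hab1 : [/\ 0 < a1, a1 <= b1 & b1 <= 1])
    (hab2 : [/\ 0 < a2, a2 <= b2 & b2 < 1 - beta2]) :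
  let g1 := weight n R1 h1 in
  let g2 := weight n R1 h2 in
  0 < (\int[lebesgue_measure]_(s in `[a1, b1]) (Phi1 beta1 eta s * g1 s))%R ->
  0 < (\int[lebesgue_measure]_(s in `[a2, b2]) (Phi2 beta2 xi s * g2 s))%R ->
  let cg1 := cgamma1 beta1 eta a1 in
  let cg2 := cgamma2 beta2 b2 in
  let c1 := Num.min (ck1 beta1 eta a1) cg1 in
  let c2 := Num.min (ck2 beta2 xi a2 b2) cg2 in
  let m1 := m_const (k1 beta1 eta) g1 in
  let m2 := m_const (k2 beta2 xi) g2 in
  let M1 := M_const (k1 beta1 eta) g1 a1 b1 in
  let M2 := M_const (k2 beta2 xi) g2 a2 b2 in
  let gam1 := gamma1 beta1 eta in
  let gam2 := gamma2 beta2 in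
  let K := cone1 a1 b1 c1 `*` cone2 a2 b2 c2 in
  (forall p, K p -> 0 <= H1 p) -> (forall p, K p -> 0 <= H2 p) ->
  compact_functional K H1 -> compact_functional K H2 ->
  0 < A1 -> 0 < A2 -> 0 < lambda1 -> 0 < lambda2 ->
  (([/\ forall p, K p -> H1 p <= A1 * norm01 p.1,
        forall z1 z2, 0 <= z1 -> f1 (z1, z2) <= lambda1 * m1 * `|z1|
      & norm01 gam1 * A1 + lambda1 < 1] /\
    [/\ forall p, K p -> H2 p >= A2 * norm01 p.2,
        forall z1 z2, 0 <= z1 -> f2 (z1, z2) >= lambda2 * M2 * z2
      & cg2 * norm01 gam2 * A2 + lambda2 > 1])
   \/
   ([/\ forall p, K p -> H2 p <= A2 * norm01 p.2,
        forall z1 z2, 0 <= z1 -> f2 (z1, z2) <= lambda2 * m2 * `|z2|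
      & norm01 gam2 * A2 + lambda2 < 1] /\
    [/\ forall p, K p -> H1 p >= A1 * norm01 p.1,
        forall z1 z2, 0 <= z1 -> f1 (z1, z2) >= lambda1 * M1 * z1
      & cg1 * norm01 gam1 * A1 + lambda1 > 1])) ->
  ~ exists p : fun01 R * fun01 R,
      [/\ K p,
          forall t, t \in `[0, 1] ->
            p.1 t = hammerstein gam1 (k1 beta1 eta) g1 f1 H1 p t,
          forall t, t \in `[0, 1] ->
            p.2 t = hammerstein gam2 (k2 beta2 xi) g2 f2 H2 p t
        & 0 < norm01_pair p].
Proof.
move=> g1 g2 int1 int2 cg1 cg2 c1 c2 m1 m2 M1 M2 gam1 gam2 K H1ge0 H2ge0 _ _.
move=> A1_gt0 A2_gt0 lambda1_gt0 lambda2_gt0 hyp [p [Kp e1 e2 p_gt0]].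
have [[cu u0 uc] [cv vc]] := Kp.
have [a1_gt0 ab1 b1_le1] := hab1; have [a2_gt0 ab2 b2_lt] := hab2.
have b2_le1 : b2 <= 1 by case/andP: hbeta2 => ? _; lra.
have ig1 := integrable_weight hn hR1 hh1.
have ig2 := integrable_weight hn hR1 hh2.
have g1_ge0 s : s \in `[0, 1] -> 0 <= g1 s by exact: weight_ge0.
have g2_ge0 s : s \in `[0, 1] -> 0 <= g2 s by exact: weight_ge0.
have bk1 := bounded_k1 heta hbeta1; have bk2 := bounded_k2 hxi hbeta2.
have c1_gt0 : 0 < c1 by rewrite lt_min ck1_gt0// cgamma1_gt0.
have c2_gt0 : 0 < c2 by rewrite lt_min ck2_gt0//=; exact: (cgamma2_gt0 hxi hbeta2).
have cF1 := continuous_nonlinearity hf1_cont cu cv u0.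
have cF2 := continuous_nonlinearity hf2_cont cu cv u0.
have F1_ge0 s : s \in `[0, 1] -> 0 <= f1 (p.1 s, p.2 s).
  by move=> s01; apply: hf1_ge0; exact: u0.
have F2_ge0 s : s \in `[0, 1] -> 0 <= f2 (p.1 s, p.2 s).
  by move=> s01; apply: hf2_ge0; exact: u0.
have uB := continuous_bounded01 cu; have vB := continuous_bounded01 cv.
suff [u_le0 v_le0] : norm01 p.1 <= 0 /\ norm01 p.2 <= 0.
  by move: p_gt0; rewrite /norm01_pair lt_max !ltNge u_le0 v_le0.
case: hyp => [[[H1le f1le small] [H2ge f2ge large]]|
              [[H2le f2le small] [H1ge f1ge large]]]; split.
- apply: (norm01_le0_small bk1 g1_ge0 ig1 _ _ uB cF1 F1_ge0 _ _ e1 small) => //.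
  + exact: gamma1_bounded.
  + by move=> s s01; apply: f1le; exact: u0.
  + by rewrite H1ge0// H1le.
- apply: (norm01_le0_large bk2 g2_ge0 ig2 (ltW a2_gt0) ab2 b2_le1
    (measurable_Phi2 _ _) _ _ int2 _ _ c2_gt0 A2_gt0 _ vB vc cF2 F2_ge0 _ _
    e2 large) => //.
  + exact: Phi2_ge0.
  + exact: k2_ge_Phi2.
  + move=> t; rewrite in_itv/= => /andP[_ tb]; exact: (cgamma2_norm_le hxi hbeta2).
  + exact: (cgamma2_gt0 hxi hbeta2).
  + by move=> s s01; apply: f2ge; exact: u0.
  + exact: H2ge.
- apply: (norm01_le0_large bk1 g1_ge0 ig1 (ltW a1_gt0) ab1 b1_le1
    (measurable_Phi1 _ _) _ _ int1 _ _ c1_gt0 A1_gt0 _ uB uc cF1 F1_ge0 _ _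
    e1 large) => //.
  + exact: Phi1_ge0.
  + exact: k1_ge_Phi1.
  + move=> t; rewrite in_itv/= => /andP[at_ _]; exact: cgamma1_norm_le.
  + exact: cgamma1_gt0.
  + by move=> s s01; apply: f1ge; exact: u0.
  + exact: H1ge.
- apply: (norm01_le0_small bk2 g2_ge0 ig2 _ _ vB cF2 F2_ge0 _ _ e2 small) => //.
  + exact: (gamma2_bounded hxi hbeta2).
  + by move=> s s01; apply: f2le; exact: u0.
  + by rewrite H2ge0// H2le.
Qed.
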